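(* Let $\mathbb{F}_q=\{0,a_1,\ldots,a_{q-1}\}$ be the finite field with $q$ elements, where $q>5$ and $\gcd(q,22)=1$, let $p$ be the characteristic of $\mathbb{F}_q$, and let $\chi$ be the quadratic multiplicative character of $\mathbb{F}_q$. Let $$S_q=\left[(a_i^2+a_ia_j+a_j^2)\,\chi(a_i^2+a_ia_j+a_j^2)\right]_{1\le i,j\le q-1},$$ a $(q-1)\times(q-1)$ matrix over $\mathbb{F}_q$. Then $$\det S_q=\frac{121}{64}\cdot T_{\frac{q+1}{2}}\cdot\prod_{k=1}^{(q-5)/2}\binom{\frac{q+1}{2}}{k}_2^2\in\mathbb{F}_p.$$ Also, $S_q$ is a singular matrix over $\mathbb{F}_q$ if and only if $$\binom{\frac{q+1}{2}}{k}_2\equiv 0\pmod p$$ for some integer $k$ with $0\le k\le (q-5)/2$.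
   Context: The elements $a_1,\ldots,a_{q-1}$ are the nonzero elements of $\mathbb{F}_q$, listed without repetition. The quadratic character $\chi$ is defined by $\chi(0)=0$, $\chi(x)=1$ if $x$ is a nonzero square in $\mathbb{F}_q$, and $\chi(x)=-1$ otherwise; its values $0,\pm1$ are regarded as elements of $\mathbb{F}_q$. For a non-negative integer $n$, the trinomial coefficients $\binom{n}{k}_2\in\mathbb{Z}$ $(-n\le k\le n)$ are defined by $$\left(x+\frac{1}{x}+1\right)^n=\sum_{k=-n}^{n}\binom{n}{k}_2x^k,$$ and $T_n=\binom{n}{0}_2$ is the central trinomial coefficient. In the determinant formula, integers and the fraction $121/64$ are viewed as elements of the prime field $\mathbb{F}_p\subseteq\mathbb{F}_q$ ($p$ is odd). *)

(* Defs.v *)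
From mathcomp Require Import all_boot all_order all_algebra.

Set Implicit Arguments.
Unset Strict Implicit.
Unset Printing Implicit Defensive.

Import Order.TTheory GRing.Theory Num.Theory.
Local Open Scope ring_scope.

Definition quad_char (F : finFieldType) (x : F) : F :=
  if x == 0 then 0 else if [exists y : F, x == y ^+ 2] then 1 else -1.

(* The coefficient of x^k in (x + 1/x + 1)^n is that of x^(n + k) in
   (x^2 + x + 1)^n, and 0 if n + k < 0; [trinomialE] and [trinomial_uniq] below
   show that these are the coefficients of the Laurent expansion. *)
Definition trinomial (n : nat) (k : int) : int :=
  if n%:Z + k is Posz m then (('X^2 + 'X + 1) ^+ n : {poly int})`_m else 0.

Definition central_trinomial (n : nat) : int := trinomial n 0.

Definition S_mx (F : finFieldType) (m : nat) (a : 'I_m -> F) : 'M[F]_m :=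
  \matrix_(i, j) let v := a i ^+ 2 + a i * a j + a j ^+ 2 in v * quad_char v.

Lemma trinomial_shift (n i : nat) :
  trinomial n (i%:Z - n%:Z) = (('X^2 + 'X + 1) ^+ n : {poly int})`_i.
Proof. by rewrite /trinomial addrC subrK. Qed.

Lemma size_trinomial_poly (n : nat) :
  (size ((('X^2 + 'X + 1) ^+ n)%R : {poly int}) <= n.*2.+1)%N.
Proof.
have s3 : (size (('X^2 + 'X + 1)%R : {poly int}) <= 3)%N.
  rewrite -addrA (leq_trans (size_polyD _ _)) // geq_max size_polyXn /=.
  by rewrite (leq_trans (size_polyD _ _)) // size_polyX size_poly1.
apply: leq_trans (size_poly_exp_leq _ _) _; rewrite ltnS -mul2n leq_mul2r.
by rewrite -subn1 leq_subLR s3 orbT.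
Qed.

Lemma laurent_base (K : fieldType) (x : K) : x != 0 ->
  x + x^-1 + 1 = (x ^+ 2 + x + 1) / x.
Proof.
move=> x0; rewrite !mulrDl expr2 mulfK // divff // mul1r -!addrA.
by rewrite [1 + _]addrC.
Qed.

Lemma trinomialE (K : fieldType) (x : K) (n : nat) : x != 0 ->
  (x + x^-1 + 1) ^+ n =
  \sum_(i < n.*2.+1) (trinomial n (i%:Z - n%:Z))%:~R * x ^ (i%:Z - n%:Z).
Proof.
move=> x0; rewrite laurent_base //.
have -> : ((x ^+ 2 + x + 1) / x) ^+ n =
  (map_poly intr (('X^2 + 'X + 1) ^+ n : {poly int})).[x] / x ^+ n.
  rewrite rmorphXn /= horner_exp !rmorphD /= map_polyXn map_polyX rmorph1.
  by rewrite !hornerE expr_div_n.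
rewrite (@horner_coef_wide _ n.*2.+1); last first.
  by rewrite (leq_trans (size_poly _ _)) ?size_trinomial_poly.
rewrite mulr_suml; apply: eq_bigr => i _.
by rewrite trinomial_shift coef_map /= expfzDr // -mulrA exprnN.
Qed.

Lemma trinomial_uniq (n : nat) (c : int -> int)
    (x := tofrac 'X : {fraction {poly int}}) :
  (x + x^-1 + 1) ^+ n =
    \sum_(i < n.*2.+1) (c (i%:Z - n%:Z))%:~R * x ^ (i%:Z - n%:Z) ->
  forall k : int, - n%:Z <= k <= n%:Z -> c k = trinomial n k.
Proof.
have x0 : x != 0 by rewrite tofrac_eq0 polyX_eq0.
have clear_den (d : int -> int) :
  (\sum_(i < n.*2.+1) (d (i%:Z - n%:Z))%:~R * x ^ (i%:Z - n%:Z)) * x ^+ n =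
  tofrac (\poly_(i < n.*2.+1) d (i%:Z - n%:Z)).
  rewrite poly_def mulr_suml rmorph_sum; apply: eq_bigr => i _ /=.
  rewrite expfzDr // -mulrA -exprnN mulfVK ?expf_neq0 //.
  have -> : (d (i%:Z - n%:Z))%:~R = tofrac (d (i%:Z - n%:Z))%:P.
    by rewrite -[in RHS](intz (d _)) !rmorph_int.
  by rewrite -mul_polyC tofracM tofracXn.
rewrite trinomialE // => /(congr1 (fun y => y * x ^+ n)).
rewrite !clear_den => /eqP; rewrite tofrac_eq => /eqP e k /andP[lk ku].
have [m km] : exists m : nat, k = m%:Z - n%:Z.
  exists (absz (k + n%:Z)%R); rewrite gez0_abs ?addrK //.
  by rewrite -[n%:Z]opprK subr_ge0.
have mn : (m < n.*2.+1)%N.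
  by move: ku; rewrite km lerBlDr -PoszD lez_nat ltnS addnn.
by have := congr1 (fun p : {poly int} => p`_m) e; rewrite !coef_poly mn -km.
Qed.

(* Main.v *)
Require Import Defs.
From mathcomp Require Import all_boot all_order all_algebra.
From mathcomp Require Import fingroup cyclic finfield.
From mathcomp Require Import ring zify.

Set Implicit Arguments.
Unset Strict Implicit.
Unset Printing Implicit Defensive.

(* By Euler's criterion v * chi v = v ^ N with N = (q + 1) / 2, so the (i, j) entry
   of S_q is the homogenized (X^2 + X + 1)^N evaluated at (a_i, a_j).  Reducing
   exponents modulo q - 1 factors S_q as V * diag b * W * diag (a_j^2), where b_m is
   the sum of the coefficients of degrees m and m + q - 1, V = (a_i^m) and
   W = (a_j^(q - 1 - m)).  Power sums over F_q^* give W * V = - I, so det S_q is the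
   product of the b_m.  Only b_0, b_1, b_2 differ from trinomial coefficients:
   b_0 = b_2 = 11/8 and b_1 = 1 since N = 1/2 in F_q; the other coefficients pair
   up by symmetry around the central one. *)

Import Order.TTheory GRing.Theory Num.Theory.
Local Open Scope ring_scope.

(** * Symmetry and low-degree values of trinomial coefficients *)

Definition trinomial_poly (n : nat) : {poly int} := ('X^2 + 'X + 1) ^+ n.

(** The base [x + x^-1 + 1] is invariant under inverting [x], and Laurent coefficients are
    unique. *)
Lemma trinomialN (n : nat) (k : int) :
  - n%:Z <= k <= n%:Z -> trinomial n (- k) = trinomial n k.
Proof.
move=> kn; apply: (trinomial_uniq (c := fun k => trinomial n (- k))) kn.
set x := tofrac 'X; have x0 : x != 0 by rewrite tofrac_eq0 polyX_eq0.
have -> : x + x^-1 + 1 = x^-1 + x^-1^-1 + 1 by rewrite invrK (addrC x).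
rewrite (trinomialE n (invr_neq0 x0)) (reindex_inj rev_ord_inj) /=.
apply: eq_bigr => i _.
have -> : (n.*2.+1 - i.+1)%N%:Z - n%:Z = - (i%:Z - n%:Z).
  by have := ltn_ord i; lia.
by rewrite -exprz_inv invrK.
Qed.

Lemma coef_trinomial_poly_rev (n i : nat) : (i <= n.*2)%N ->
  (trinomial_poly n)`_(n.*2 - i) = (trinomial_poly n)`_i.
Proof.
move=> i2n; rewrite -!trinomial_shift -[RHS]trinomialN; last by lia.
by congr trinomial; lia.
Qed.

(** Degree 2 is stated doubled, so that n(n + 1)/2 needs no division over the integers. *)
Lemma coef_trinomial_poly_low (n : nat) :
  [/\ (trinomial_poly n)`_0 = 1, (trinomial_poly n)`_1 = n%:R
    & (trinomial_poly n)`_2 *+ 2 = n%:R * n.+1%:R].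
Proof.
rewrite /trinomial_poly; elim: n => [|n [c0 c1 c2]]; first by rewrite expr0 !coef1.
rewrite exprS !mulrDl mul1r !coefD !coefXnM !coefXM /= c0 c1.
by split; rewrite ?mulrnDl ?c2; ring.
Qed.

Lemma prod_nat_centered (R : comPzRingType) (f : nat -> R) (n j : nat) : (j <= n)%N ->
  \prod_(n - j <= i < (n + j).+1) f i =
    f n * \prod_(1 <= k < j.+1) (f (n - k)%N * f (n + k)%N).
Proof.
elim: j => [|j IHj] jn; first by rewrite subn0 addn0 big_nat1 big_geq ?mulr1.
rewrite big_ltn; last by lia.
rewrite big_nat_recr /=; last by lia.
have -> : (n - j.+1).+1 = (n - j)%N by lia.
rewrite addnS IHj; last by lia.
by rewrite [in RHS]big_nat_recr //= addnS; ring.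
Qed.

(** * Power sums and Euler's criterion in a finite field *)

Section FiniteField.

Variable F : finFieldType.

Lemma card_finField_eq0 : #|F|%:R = 0 :> F.
Proof.
have: (#[1%R : F]%g %| #|[set: F]|)%N by apply: order_dvdG; rewrite inE.
by rewrite order_dvdn cardsT FinRing.zmodXgE => /eqP.
Qed.

Lemma expf_card_pred (x : F) : x != 0 -> x ^+ #|F|.-1 = 1.
Proof.
move=> x0; apply: (mulfI x0).
by rewrite mulr1 -exprS prednK ?expf_card //; apply/card_gt0P; exists 0.
Qed.

Lemma finField_prim_root : exists g : F, #|F|.-1.-primitive_root g.
Proof.
have: has #|F|.-1.-primitive_root (enum [pred x : F | x != 0]).
  apply: has_prim_root; last 1 first.
  - by rewrite -cardE -(cardC1 (0 : F)).
  - by rewrite -subn1 subn_gt0 finNzRing_gt1.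
  - apply/allP=> x; rewrite mem_enum inE => x0.
    by apply/unity_rootP; apply: expf_card_pred.
  - exact: enum_uniq.
by move/hasP=> [g _ gP]; exists g.
Qed.

(** Multiplication by a primitive root [g] permutes the nonzero elements, so the sum is fixed by the
    factor [g ^+ d], which differs from 1 unless [#|F|.-1] divides [d]. In that case all terms are 1
    and their number is -1 in [F]. *)
Lemma sum_expf_neq0 (d : nat) :
  \sum_(x : F | x != 0) x ^+ d = - (#|F|.-1 %| d)%:R.
Proof.
have [g gP] := finField_prim_root.
case: (boolP (#|F|.-1 %| d)%N) => [/dvdnP[k ->]|].
  under eq_bigr => x x0 do rewrite mulnC exprM expf_card_pred // expr1n.
  rewrite sumr_const (_ : #|_| = #|F|.-1); last by rewrite -(cardC1 (0 : F)).
  apply/eqP; rewrite -addr_eq0 -natrD addn1 prednK; first by rewrite card_finField_eq0.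
  by apply/card_gt0P; exists 0.
rewrite (prim_order_dvd gP) oppr0 => gd.
have g0 : g != 0.
  apply/eqP => g0; move: (prim_expr_order gP).
  by rewrite g0 expr0n gtn_eqF ?(prim_order_gt0 gP) // => /esym/eqP; rewrite oner_eq0.
have E : \sum_(x : F | x != 0) x ^+ d = g ^+ d * \sum_(x : F | x != 0) x ^+ d.
  rewrite [LHS](reindex_inj (mulfI g0)) mulr_sumr /=.
  by apply: eq_big => [x|x _]; rewrite ?exprMn // mulf_eq0 negb_or g0.
apply/eqP; move/eqP: E; rewrite -subr_eq0 -{1}[\sum_(x | _) _]mul1r -mulrBl.
by rewrite mulf_eq0 subr_eq0 eq_sym (negPf gd).
Qed.

(** Inverting [x] in one of the two copies of the product makes the factors cancel. *)
Lemma prod_sqr_finField_neq0 : \prod_(x : F | x != 0) x ^+ 2 = 1.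
Proof.
under eq_bigr do rewrite expr2.
rewrite big_split /= [X in X * _](reindex_inj invr_inj) /=.
under eq_bigl do rewrite invr_eq0.
by rewrite -big_split /=; apply: big1 => x x0; rewrite mulVf.
Qed.

Lemma mulf_quad_char (v : F) : odd #|F| ->
  v * quad_char v = v ^+ (#|F|.+1 %/ 2).
Proof.
move=> oF; have [g gP] := finField_prim_root.
have F_gt1 : (1 < #|F|)%N := finNzRing_gt1 F.
set m := (#|F| %/ 2)%N.
have Fm : #|F|.-1 = (m * 2)%N by rewrite /m; lia.
have -> : (#|F|.+1 %/ 2 = m.+1)%N by rewrite /m; lia.
rewrite /quad_char; have [->|v0] := eqVneq; first by rewrite mul0r expr0n.
rewrite exprS; congr (_ * _); case: existsP => [[y /eqP vy]|nsq].
  rewrite vy -exprM mulnC -Fm expf_card_pred //.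
  by apply: contraNneq v0 => y0; rewrite vy y0 expr0n.
(* Write [v = g ^+ i]: then [v ^+ m = 1] forces [m * 2] to divide [i * m], so [i] is even and [v] is
   a square. *)
have v1 : v ^+ m != 1.
  apply/negP => v1; apply: nsq.
  have [[i /= _] vE] := prim_rootP gP (expf_card_pred v0).
  move: v1; rewrite vE -exprM -(prim_order_dvd gP) Fm [(i * m)%N]mulnC.
  rewrite dvdn_pmul2l; last by rewrite /m; lia.
  by case/dvdnP=> k ik; exists (g ^+ k); rewrite ik exprM.
have : (v ^+ m) ^+ 2 == 1 by rewrite -exprM -Fm expf_card_pred.
by rewrite sqrf_eq1 (negPf v1) => /eqP.
Qed.

(** * Factorization of the matrix and the determinant as an integer *)

Section Listing.

Variables (a : 'I_#|F|.-1 -> F) (a_inj : injective a) (a_neq0 : forall i, a i != 0).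

Lemma big_listing (R : Type) (idx : R) (op : Monoid.com_law idx) (f : F -> R) :
  \big[op/idx]_i f (a i) = \big[op/idx]_(x | x != 0) f x.
Proof.
rewrite -[RHS]big_enum -big_image; apply: perm_big.
have u : uniq [seq a i | i in 'I_#|F|.-1] by rewrite map_inj_uniq ?enum_uniq.
apply: uniq_perm => //; first exact: enum_uniq.
have sub : {subset [seq a i | i in 'I_#|F|.-1] <= enum (fun x : F => x != 0)}.
  by move=> x /imageP[i _ ->]; rewrite mem_enum; apply: a_neq0.
case: (uniq_min_size u sub) => //.
by rewrite size_map -!cardE card_ord -(cardC1 (0 : F)).
Qed.

Lemma sum_expf_listing (d : nat) : \sum_i a i ^+ d = - (#|F|.-1 %| d)%:R.
Proof. by rewrite (big_listing _ (fun x => x ^+ d)) sum_expf_neq0. Qed.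

Let r := #|F|.-1.
Let N := (#|F|.+1 %/ 2)%N.
Let b (i : nat) : int := (trinomial_poly N)`_i + (trinomial_poly N)`_(r + i).

Hypotheses (F_odd : odd #|F|) (F_gt5 : (5 < #|F|)%N).

Lemma S_mxE (i j : 'I_r) :
  S_mx a i j = \sum_(m < r) a i ^+ m * (b m)%:~R * a j ^+ (r - m) * a j ^+ 2.
Proof.
rewrite mxE /= mulf_quad_char // -/N.
set x := a i; set y := a j; have y0 : y != 0 := a_neq0 j.
have Nr : N.*2 = r.+2 by rewrite /N /r; lia.
have -> : x ^+ 2 + x * y + y ^+ 2 = y ^+ 2 * ((x / y) ^+ 2 + x / y + 1) by field.
rewrite exprMn -exprM mul2n Nr; set z := x / y.
have z0 : z != 0 by rewrite mulf_neq0 ?invr_eq0 ?a_neq0.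
have -> : (z ^+ 2 + z + 1) ^+ N = (map_poly intr (trinomial_poly N)).[z].
  rewrite rmorphXn /= horner_exp !rmorphD /= map_polyXn map_polyX rmorph1.
  by rewrite !hornerE.
(* The degree [r + 2] is below [r + r] because [5 < #|F|], so two blocks of [r] coefficients
   suffice; [z ^+ r = 1] then merges them. *)
rewrite (@horner_coef_wide _ (r + r)); last first.
  rewrite (leq_trans (size_poly _ _)) // (leq_trans (size_trinomial_poly _)) // Nr.
  by rewrite /r; lia.
rewrite big_split_ord /= -big_split mulr_sumr; apply: eq_bigr => m _ /=.
rewrite !coef_map /= exprD expf_card_pred // mul1r -mulrDl -rmorphD /= -/(b m).
have -> : y ^+ r.+2 = y ^+ m * y ^+ (r - m) * y ^+ 2.
  by rewrite -!exprD; congr (_ ^+ _); have := ltn_ord m; lia.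
have -> : x ^+ m = z ^+ m * y ^+ m by rewrite -exprMn divfK.
ring.
Qed.

Lemma det_S_mx : \det (S_mx a) = (\prod_(m < r) b m)%:~R.
Proof.
pose V : 'M[F]_r := \matrix_(i, m) a i ^+ m.
pose W : 'M[F]_r := \matrix_(m, j) a j ^+ (r - m).
have -> : S_mx a =
    V *m diag_mx (\row_m (b m)%:~R) *m W *m diag_mx (\row_j a j ^+ 2).
  apply/matrixP=> i j; rewrite S_mxE mul_mx_diag [RHS]mxE [X in X * _]mxE.
  rewrite [in RHS]mxE mulr_suml.
  by apply: eq_bigr => m _; rewrite mul_mx_diag !mxE.
have WV : \det W * \det V = 1.
  rewrite -det_mulmx; have -> : W *m V = (-1)%:M.
    apply/matrixP=> m l; rewrite !mxE.
    under eq_bigr => j _ do rewrite !mxE -exprD.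
    rewrite sum_expf_listing -/r -mulNrn.
    (* The exponent lies strictly between 0 and [2 r], so the only multiple of [r] it can be is [r]
       itself. *)
    have -> // : (r %| r - m + l)%N = (m == l).
    rewrite -val_eqE /=; have := ltn_ord m; have := ltn_ord l; move: (val m) (val l).
    move=> m' l' lr mr; apply/dvdnP/eqP => [[k E]|->]; last by exists 1%N; lia.
    by have k1 : k = 1%N; [nia | rewrite k1 in E; lia].
  (* The determinant of - I is (-1)^r, and [r] is even because [#|F|] is odd. *)
  by rewrite det_scalar -signr_odd (_ : odd r = false) // /r; lia.
rewrite !det_mulmx !det_diag rmorph_prod /=.
under [X in _ * X]eq_bigr do rewrite mxE.
rewrite (big_listing _ (fun x => x ^+ 2)) prod_sqr_finField_neq0 mulr1 mulrAC.
by rewrite [_ * \det W]mulrC WV mul1r; apply: eq_bigr => m _; rewrite mxE.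
Qed.

(** The degree is [r + 2], so only [m = 0, 1, 2] pick up a second coefficient, which symmetry
    identifies with that of degree 2, 1, 0 respectively. *)
Lemma prod_merged_coef :
  \prod_(m < r) b m = (1 + (trinomial_poly N)`_2) ^+ 2 * (N%:R *+ 2) *
    (central_trinomial N * \prod_(1 <= k < ((#|F| - 5) %/ 2).+1) trinomial N k%:Z ^+ 2).
Proof.
have Nr : N.*2 = r.+2 by rewrite /N /r; lia.
have [c0 c1 _] := coef_trinomial_poly_low N.
have tE (k : nat) : trinomial N k%:Z = (trinomial_poly N)`_(N + k) by [].
have rev i j : (i + j = N.*2)%N -> (trinomial_poly N)`_i = (trinomial_poly N)`_j.
  by move=> ij; rewrite -[RHS]coef_trinomial_poly_rev; [congr _`_ _|]; lia.
rewrite -(big_mkord xpredT b) big_ltn; last by lia.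
rewrite big_ltn; last by lia.
rewrite big_ltn; last by lia.
have -> : b 0 = 1 + (trinomial_poly N)`_2 by rewrite /b c0 (rev _ 2%N) //; lia.
have -> : b 1 = N%:R *+ 2 by rewrite /b (rev (r + 1)%N 1%N) ?c1 ?mulr2n //; lia.
have -> : b 2 = 1 + (trinomial_poly N)`_2.
  by rewrite /b (rev (r + 2)%N 0%N) ?c0 1?addrC //; lia.
set j := ((#|F| - 5) %/ 2)%N.
have -> : \prod_(3 <= i < r) b i =
    central_trinomial N * \prod_(1 <= k < j.+1) trinomial N k%:Z ^+ 2.
  (* The remaining degrees 3 to [r - 1] form the window of radius [j] around the centre [N]. *)
  have jN : (N - j = 3)%N by rewrite /j /N; lia.
  have -> : \prod_(3 <= i < r) b i = \prod_(N - j <= i < (N + j).+1) (trinomial_poly N)`_i.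
    rewrite jN; have -> : (N + j).+1 = r by lia.
    apply: eq_big_nat => i /andP[i3 ir].
    (* For [i] at least 3 the index [r + i] exceeds the degree, and the default 0 is read. *)
    rewrite /b [X in _ + X]nth_default ?addr0 //.
    by apply: leq_trans (size_trinomial_poly _) _; lia.
  rewrite prod_nat_centered; last by lia.
  congr (_ * _); first by rewrite /central_trinomial tE addn0.
  apply: eq_big_nat => k /andP[k1 kj].
  by rewrite tE (rev (N - k)%N (N + k)%N) //; lia.
ring.
Qed.

End Listing.
End FiniteField.

(** * Evaluation in the field and the singularity criterion *)

Theorem theorem1p2 (F : finFieldType) (q p : nat) (a : 'I_q.-1 -> F)
    (hq : #|F| = q) (q_gt5 : (5 < q)%N) (q_coprime : gcdn q 22 = 1%N)
    (hp : p \in [pchar F])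
    (a_inj : injective a) (a_neq0 : forall i, a i != 0) :
  [/\ \det (S_mx a) =
        121%:R / 64%:R * (central_trinomial (q.+1 %/ 2)%N)%:~R *
        \prod_(1 <= k < ((q - 5) %/ 2).+1)
           (trinomial (q.+1 %/ 2)%N k%:Z)%:~R ^+ 2,
      exists z : 'F_p, \det (S_mx a) = (z : nat)%:R
    & S_mx a \notin unitmx <->
      exists k : int, [/\ 0 <= k, k <= ((q - 5) %/ 2)%N%:Z
        & (trinomial (q.+1 %/ 2)%N k = 0 %[mod p%:Z])%Z]].
Proof.
subst q.
have p_prime : prime p := pcharf_prime hp.
have F_odd : odd #|F|.
  apply/negbNE; rewrite -dvdn2; apply/negP => F2.
  by have := dvdn_gcd 2 #|F| 22; rewrite q_coprime F2.
have pF : (p %| #|F|)%N by rewrite (dvdn_pcharf hp) card_finField_eq0.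
have p22 : coprime p 22 by apply: coprime_dvdl pF _; apply/eqP.
(* A prime divisor of 22 differs from [p], which is coprime to 22; this makes 2 and 11
   invertible. *)
have p_neq q' : prime q' -> (q' %| 22)%N -> (q'%:R : F) != 0.
  move=> q'_prime q'22; rewrite -(dvdn_pcharf hp) prime_coprime // in p22 *.
  by apply: contra p22; rewrite dvdn_prime2 // => /eqP ->.
have two0 : (2%:R : F) != 0 by apply: p_neq.
have eleven0 : (11%:R : F) != 0 by apply: p_neq.
have detE := etrans (det_S_mx a_inj a_neq0 F_odd q_gt5)
  (congr1 intr (prod_merged_coef F_odd q_gt5)).
set N := (#|F|.+1 %/ 2)%N in detE *.
set h := ((#|F| - 5) %/ 2)%N in detE *.
have N2 : (N%:R *+ 2 : F) = 1.
  rewrite -mulrnA (_ : N * 2 = #|F| + 1)%N; last by rewrite /N; lia.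
  by rewrite natrD card_finField_eq0 add0r.
(* As 2N = 1 in [F], eight times the degree-2 coefficient is 4N(N + 1) = 2N(2N + 2) = 3, and 8 + 3 =
   11. *)
have c2 : 8%:R * (1 + (trinomial_poly N)`_2)%:~R = 11%:R :> F.
  have [_ _ /(congr1 (fun n => n%:~R : F))] := coef_trinomial_poly_low N.
  rewrite rmorphMn rmorphM !rmorph_nat /= rmorphD rmorph1 => E.
  have {}E : 8%:R * ((trinomial_poly N)`_2)%:~R = (N%:R *+ 2) * (N%:R *+ 2 + 2%:R) :> F.
    rewrite (_ : 8%:R * _ = ((trinomial_poly N)`_2)%:~R *+ 2 * 4%:R :> F); last by ring.
    by rewrite E -addn1 natrD; ring.
  by rewrite mulrDr E N2; ring.
have detF : \det (S_mx a) =
    121%:R / 64%:R * (central_trinomial N)%:~R *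
    \prod_(1 <= k < h.+1) (trinomial N k%:Z)%:~R ^+ 2.
  rewrite detE intrM [X in X * _]intrM [X in _ * X]intrM rmorphXn rmorphMn.
  rewrite rmorph_nat /= N2 mulr1 mulrA.
  have -> : 121%:R / 64%:R = (1 + (trinomial_poly N)`_2)%:~R ^+ 2 :> F.
    apply/(canLR (mulfK _)); first by rewrite (natrX _ 2 6) expf_neq0.
    by rewrite (natrX _ 11 2) -c2; ring.
  by congr (_ * _); rewrite rmorph_prod; apply: eq_bigr => k _; rewrite rmorphXn.
split=> //.
  move: detE; set d := (X in X%:~R) => ->.
  have p_neq0 : p%:Z != 0 by rewrite eqz_nat -lt0n prime_gt0.
  (* The determinant is the image of the integer [d], so the residue of [d] modulo [p] is the
     witness. *)
  exists (absz (d %% p)%Z)%:R; rewrite val_Fp_nat // modn_small; last first.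
    by rewrite -ltz_nat gez0_abs ?modz_ge0 // ltz_pmod // ltz_nat prime_gt0.
  rewrite [RHS]pmulrn gez0_abs ?modz_ge0 //.
  rewrite [in LHS](divz_eq d p) rmorphD rmorphM /=.
  by rewrite -[p%:~R]pmulrn (pcharf0 hp) mulr0 add0r.
have mod0 t : (t = 0 %[mod p])%Z <-> t%:~R = 0 :> F.
  rewrite mod0z; split=> [/dvdz_mod0P|/eqP]; first by rewrite (dvdz_pcharf hp) => /eqP.
  by rewrite -(dvdz_pcharf hp) => /dvdz_mod0P.
have c0 : 121%:R / 64%:R != 0 :> F.
  by rewrite (natrX _ 11 2) (natrX _ 2 6) mulf_neq0 ?invr_eq0 ?expf_neq0.
rewrite unitmxE unitfE negbK detF -mulrA mulf_eq0 (negPf c0) /= mulf_eq0.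
(* The index 0 corresponds to the central factor, positive indices to the squared factors of the
   product. *)
split=> [/orP[/eqP t0|]|[k [k0 kh /mod0 tk]]].
- by exists 0; split=> //; apply/mod0.
- rewrite prodf_seq_eq0 => /hasP[k]; rewrite mem_index_iota => /andP[_ kh].
  by rewrite /= expf_eq0 => /eqP tk; exists k%:Z; split=> //; apply/mod0.
case: k k0 kh tk => // -[|k] _ kh tk; first by rewrite tk eqxx.
apply/orP; right; rewrite prodf_seq_eq0; apply/hasP; exists k.+1.
  by rewrite mem_index_iota.
by rewrite /= tk expr0n.
Qed.
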